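(* Let $z\in Z$ and set $\ell=\mathbb{Q}(\sqrt{z})$. Let $w\in Z$ and let $d=\gcd(z,w)>0$. Then $w\in n_{\ell/\mathbb{Q}}(\ell^* )$ if and only if all of the following four conditions are satisfied: (1) $z,w$ are not both negative; (2) $z$ is a square mod $\tfrac{w}{d}$; (3) $w$ is a square mod $\tfrac{z}{d}$; (4) $-\tfrac{zw}{d^2}$ is a square mod $d$.
   Context: $Z$ denotes the set of all square-free integers (positive or negative, non-zero) except $1$; thus $-1\in Z$. $\ell^*=\ell\setminus\{0\}$, and $n_{\ell/\mathbb{Q}}(x)=x\overline{x}$ is the norm of the quadratic extension $\mathbb{Q}\subset\ell$, where $\overline{x}$ is the Galois conjugate of $x$. For integers $a$ and $m\neq0$, ''$a$ is a square mod $m$'' means that there is an integer $t$ with $t^2\equiv a\pmod{m}$ (which is automatic if $m=\pm1$). *)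

(* Defs.v *)
From HB Require Import structures.
From mathcomp Require Import all_boot all_order all_algebra all_field.

Set Implicit Arguments.
Unset Strict Implicit.
Unset Printing Implicit Defensive.

Import Order.TTheory GRing.Theory Num.Theory.
Local Open Scope ring_scope.

(* 0 is excluded, since every square divides it. *)
Definition squarefreez (z : int) : Prop :=
  forall m : int, (m ^+ 2 %| z)%Z -> `|m| = 1.

Definition in_Z (z : int) : Prop := squarefreez z /\ z <> 1.

Definition is_square_mod (a m : int) : Prop :=
  exists t : int, (t ^+ 2 = a %[mod m])%Z.

(* L is, up to isomorphism, the field Q(sqrt z). *)
Definition is_Qsqrt (z : int) (L : splittingFieldType rat) : Prop :=
  exists s : L, s ^+ 2 = z%:~R /\ <<1; s>>%VS = {:L}%VS.

(* The norm of L over Q; for quadratic L, 'Gal({:L} / 1) consists of the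
   identity and of the conjugation, so that this is x times its conjugate. *)
Definition normQ (L : splittingFieldType rat) (x : L) : L :=
  galNorm 1 {:L} x.

Definition is_norm_from (L : splittingFieldType rat) (w : int) : Prop :=
  exists x : L, x != 0 /\ normQ x = w%:~R.

(* Main.v *)
Require Import Defs.
From HB Require Import structures.
From mathcomp Require Import all_boot all_order all_algebra all_field.
From mathcomp Require Import ring zify.

(** The norm of [x + y sqrt z] is [x^2 - z y^2], so that [w] is a norm if and only
    if the ternary form [z x^2 + w y^2 - t^2] has a nontrivial rational zero, or
    equivalently an integral one ([is_norm_fromP]). The statement is therefore
    Legendre's theorem on such forms.

    The conditions are necessary ([isotropic_legendre_conditions]): in a solution
    with [x] and [y] coprime, squarefreeness of [z] and [w] makes [x] invertible
    modulo [w] and [y] invertible modulo [z], so reducing the equation modulo [w],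
    modulo [z], and, once divided by [d], modulo [d], yields the three congruence
    conditions.

    They are sufficient by Lagrange's descent ([legendre_conditions_isotropic]).
    For coefficients [a] and [b] with [|b| < |a|], the integer [b] is a square
    modulo [a], so [t^2 - b = a c m^2] with [|t| <= |a| / 2] and [c] squarefree.
    Then [|c| < |a|], the conditions pass from [(a, b)] to [(c, b)]
    ([legendre_conditions_descent]), and a solution for [(c, b)] yields one for
    [(a, b)], because [a c m^2] is a norm from [Q(sqrt b)] ([isotropic_descent]). *)

Set Implicit Arguments.
Unset Strict Implicit.
Unset Printing Implicit Defensive.

Import Order.TTheory GRing.Theory Num.Theory.
Local Open Scope ring_scope.

(** * Squarefree integers *)

Lemma squarefreez_neq0 (a : int) : squarefreez a -> a != 0.
Proof. by move=> sa; apply/eqP=> a0; have := sa 2; rewrite a0 dvdz0 => /(_ isT). Qed.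

Lemma squarefreez_dvd a b : (a %| b)%Z -> squarefreez b -> squarefreez a.
Proof. by move=> ab sb m ma; apply/sb/(dvdz_trans ma). Qed.

(** The square of the gcd of the two factors divides the product. *)
Lemma squarefreez_coprime a b : squarefreez (a * b) -> coprimez a b.
Proof.
move=> sab; have: `|gcdz a b| = 1.
  by apply: sab; rewrite expr2 dvdz_mul ?dvdz_gcdl ?dvdz_gcdr.
by rewrite /coprimez ger0_norm // => ->.
Qed.

Lemma coprimez_div_gcd (a b : int) : a != 0 ->
  coprimez (a %/ gcdz a b)%Z (b %/ gcdz a b)%Z.
Proof.
move=> a0; set g := gcdz a b.
have g0 : g != 0 by rewrite gcdz_eq0 negb_and a0.
have := mulz_gcdl (a %/ g)%Z (b %/ g)%Z g.
rewrite !divzK ?dvdz_gcdl ?dvdz_gcdr // -/g abszE ger0_norm //.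
by rewrite -[RHS]mul1r => /(mulIf g0)/eqP.
Qed.

(** Names the gcd and the two cofactors at once, so that the argument can go on
    with equations between variables instead of quotients. *)
Lemma gcdz_factor (a b : int) : a != 0 -> exists d a1 b1 : int,
  [/\ d != 0, gcdz a b = d, a = a1 * d, b = b1 * d & coprimez a1 b1] /\
  (a %/ d)%Z = a1 /\ (b %/ d)%Z = b1.
Proof.
move=> a0; exists (gcdz a b), (a %/ gcdz a b)%Z, (b %/ gcdz a b)%Z.
split=> //; split=> //; rewrite ?divzK ?dvdz_gcdl ?dvdz_gcdr //.
  by rewrite gcdz_eq0 negb_and a0.
exact: coprimez_div_gcd.
Qed.

(** Write [d = e g] and [x = y g] with [g] their gcd. Then [e] is prime to [y],
    and also to [g] because [d] is squarefree; but [e] divides [g y^2], so it is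
    a unit. *)
Lemma squarefreez_dvd_sqr d x : squarefreez d -> (d %| x ^+ 2)%Z -> (d %| x)%Z.
Proof.
move=> sd; have d0 := squarefreez_neq0 sd.
have := coprimez_div_gcd x d0; set g := gcdz d x => cey.
have g0 : g != 0 by rewrite gcdz_eq0 negb_and d0.
have de : d = (d %/ g)%Z * g by rewrite divzK ?dvdz_gcdl.
have xy : x = (x %/ g)%Z * g by rewrite divzK ?dvdz_gcdr.
move: (d %/ g)%Z (x %/ g)%Z de xy cey => e y de xy cey.
have ceg : coprimez e g by apply: squarefreez_coprime; rewrite -de.
rewrite de xy (_ : (y * g) ^+ 2 = (g * y ^+ 2) * g); last by ring.
rewrite dvdz_mul2r // Gauss_dvdzr // -[y ^+ 2]mulr1.
rewrite Gauss_dvdzr ?coprimezXr // => e1.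
by rewrite dvdz_mul2r // (dvdz_trans e1) // dvdzE dvd1n.
Qed.

(** The square part is the largest square dividing [n]: a square factor of the
    cofactor would enlarge it. *)
Lemma squarefreez_decomposition n : n != 0 ->
  exists a m : int, [/\ n = a * m ^+ 2, squarefreez a & m != 0].
Proof.
move=> n0.
pose P k := (k%:Z ^+ 2 %| n)%Z && (0 < k)%N.
have exP : exists k, P k by exists 1%N; rewrite /P expr1n dvd1z.
have leP k : P k -> (k <= `|n|)%N.
  case/andP=> + k0; rewrite dvdzE abszX => /dvdn_leq; rewrite absz_gt0 n0.
  by move/(_ isT); apply: leq_trans; rewrite expnS expn1 leq_pmulr.
case: (ex_maxnP exP leP) => m /andP[/dvdzP[a na] m0] mmax.
exists a, m%:Z; split=> //; last by rewrite eqz_nat -lt0n.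
move=> k /dvdzP[c ac].
have k0 : (0 < `|k|)%N.
  rewrite absz_gt0; apply: contraNneq n0 => k0.
  by rewrite na ac k0 expr0n mulr0 mul0r.
have : (`|k| * m <= m)%N.
  apply: mmax; rewrite /P muln_gt0 k0 m0 andbT na ac PoszM exprMn abszE.
  by rewrite real_normK ?num_real // -mulrA dvdz_mull.
by rewrite -{2}[m]mul1n leq_pmul2r // => km; apply/eqP; lia.
Qed.

(** * Squares modulo an integer *)

Lemma is_square_modP a m :
  is_square_mod a m <-> exists t : int, (m %| t ^+ 2 - a)%Z.
Proof.
split=> -[t ht]; exists t; first by rewrite -eqz_mod_dvd ht.
by apply/eqP; rewrite eqz_mod_dvd.
Qed.

Lemma is_square_mod_dvd a m n :
  (n %| m)%Z -> is_square_mod a m -> is_square_mod a n.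
Proof.
move=> nm /is_square_modP[t ht]; apply/is_square_modP.
by exists t; apply: dvdz_trans ht.
Qed.

Lemma is_square_mod_congr a b m :
  (m %| a - b)%Z -> is_square_mod a m -> is_square_mod b m.
Proof.
move=> ab /is_square_modP[t ht]; apply/is_square_modP; exists t.
rewrite (_ : _ - b = (t ^+ 2 - a) + (a - b)); last by ring.
by rewrite rpredD.
Qed.

Lemma is_square_mod_sqr a m : is_square_mod (a ^+ 2) m.
Proof. by exists a. Qed.

Lemma is_square_modM a b m :
  is_square_mod a m -> is_square_mod b m -> is_square_mod (a * b) m.
Proof.
move=> /is_square_modP[s hs] /is_square_modP[t ht]; apply/is_square_modP.
exists (s * t).
rewrite (_ : _ - _ = (s ^+ 2 - a) * t ^+ 2 + a * (t ^+ 2 - b)); last by ring.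
by apply: rpredD; [exact: dvdz_mulr|exact: dvdz_mull].
Qed.

(** With [u] an inverse of [c] modulo [m], [a] is congruent to [u^2 * c * (c a)],
    a product of squares. *)
Lemma is_square_mod_cancel c a m : coprimez c m ->
  is_square_mod c m -> is_square_mod (c * a) m -> is_square_mod a m.
Proof.
move=> /coprimezP[[u v] /= uv] sc sca.
have su : is_square_mod (u ^+ 2 * (c * (c * a))) m.
  by apply: is_square_modM (is_square_modM sc sca); apply: is_square_mod_sqr.
apply: is_square_mod_congr su; apply/dvdzP; exists (- v * a * (u * c + 1)).
have uc : u * c = 1 - v * m by rewrite -uv; ring.
rewrite (_ : _ - a = (u * c) ^+ 2 * a - a); last by ring.
by rewrite uc; ring.
Qed.

(** Glue square roots modulo [m] and [n] by the Chinese remainder theorem. *)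
Lemma is_square_mod_chinese a m n : coprimez m n ->
  is_square_mod a m -> is_square_mod a n -> is_square_mod a (m * n).
Proof.
move=> mn /is_square_modP[s hs] /is_square_modP[t ht]; apply/is_square_modP.
have cong x y k : (k %| x - y)%Z -> (k %| y ^+ 2 - a)%Z -> (k %| x ^+ 2 - a)%Z.
  move=> xy ya; rewrite (_ : _ - a = (x - y) * (x + y) + (y ^+ 2 - a)); last by ring.
  by rewrite rpredD ?dvdz_mulr.
exists (zchinese m n s t); rewrite Gauss_dvdz //; apply/andP; split.
  by apply: cong hs; rewrite -eqz_mod_dvd; apply/eqP/zchinese_modl.
by apply: cong ht; rewrite -eqz_mod_dvd; apply/eqP/zchinese_modr.
Qed.

(** The descent needs a square root of absolute value at most [|m| / 2], that
    is, one taken in a symmetric system of residues. *)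
Lemma is_square_mod_small a m : m != 0 -> is_square_mod a m ->
  exists t : int, (m %| t ^+ 2 - a)%Z /\ 2 * `|t| <= `|m|.
Proof.
move=> m0 /is_square_modP[s hs].
have cong x : (m %| x - s)%Z -> (m %| x ^+ 2 - a)%Z.
  move=> xs; rewrite (_ : _ - a = (x - s) * (x + s) + (s ^+ 2 - a)); last by ring.
  by rewrite rpredD ?dvdz_mulr.
have rs : (m %| (s %% m)%Z - s)%Z by rewrite -eqz_mod_dvd modz_mod.
have r0 : 0 <= (s %% m)%Z by apply: modz_ge0.
have rm : (s %% m)%Z < `|m| by rewrite -abszE ltz_mod.
have [small|big] := lerP (2 * (s %% m)%Z) `|m|.
  by exists (s %% m)%Z; rewrite ger0_norm // cong.
exists ((s %% m)%Z - `|m|); split; last by lia.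
apply: cong; rewrite addrAC rpredB // dvdzE abszE; lia.
Qed.

(** * Isotropy and the local conditions *)

Definition isotropic (a b : int) : Prop :=
  exists x y z : int,
    [|| x != 0, y != 0 | z != 0] /\ a * x ^+ 2 + b * y ^+ 2 = z ^+ 2.

(** The local conditions in a form that is symmetric in [a] and [b] and easier to
    carry through the descent: the moduli of the second and third conditions are
    [b] and [a] themselves and not their quotients by the gcd. *)
Definition legendre_conditions (a b : int) : Prop :=
  let d := gcdz a b in
  [/\ ~ (a < 0 /\ b < 0), is_square_mod a b, is_square_mod b a &
      is_square_mod (- ((a %/ d)%Z * (b %/ d)%Z)) d].

Lemma isotropicC a b : isotropic a b -> isotropic b a.
Proof.
by case=> x [y [z [nz e]]]; exists y, x, z; rewrite orbCA addrC e.
Qed.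

Lemma legendre_conditionsC a b :
  legendre_conditions a b -> legendre_conditions b a.
Proof.
case=> s1 s2 s3 s4; split=> //; first by case=> ? ?; apply: s1.
by rewrite gcdzC mulrC.
Qed.

(** A squarefree [w] is the product of the coprime integers [d] and [w / d], and
    [z] vanishes modulo [d]; hence [z] is a square modulo [w] as soon as it is one
    modulo [w / d]. *)
Lemma legendre_conditionsE z w : squarefreez z -> squarefreez w ->
  let d := gcdz z w in
  legendre_conditions z w <->
  [/\ ~ (z < 0 /\ w < 0),
      is_square_mod z (w %/ d)%Z,
      is_square_mod w (z %/ d)%Z &
      is_square_mod (- ((z * w) %/ d ^+ 2)%Z) d].
Proof.
move=> sz sw d.
have d0 : d != 0 by rewrite gcdz_eq0 negb_and squarefreez_neq0.
have dz : (d %| z)%Z by apply: dvdz_gcdl.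
have dw : (d %| w)%Z by apply: dvdz_gcdr.
have -> : ((z * w) %/ d ^+ 2)%Z = (z %/ d)%Z * (w %/ d)%Z.
  rewrite -{1}(divzK dz) -{1}(divzK dw).
  rewrite (_ : _ * _ = (z %/ d)%Z * (w %/ d)%Z * d ^+ 2); last by ring.
  by rewrite mulzK // expf_neq0.
have full x y : squarefreez x -> (d %| x)%Z -> (d %| y)%Z ->
    is_square_mod y x <-> is_square_mod y (x %/ d)%Z.
  move=> sx dx dy; split.
    by apply: is_square_mod_dvd; apply/dvdzP; exists d; rewrite mulrC divzK.
  move=> h; rewrite -(divzK dx); apply: is_square_mod_chinese => //.
    by apply: squarefreez_coprime; rewrite divzK.
  by apply/is_square_modP; exists 0; rewrite expr0n sub0r rpredN.
have hw := full w z sw dw dz; have hz := full z w sz dz dw.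
by split=> -[s1 s2 s3 s4]; split=> //; by [apply/hw | apply/hz].
Qed.

(** * Necessity *)

(** A common divisor [g] of [x] and [b] divides [z^2], hence [z] as it is
    squarefree; then [g^2] divides [b y^2], hence [b]. *)
Lemma coprimez_of_norm_equation b c x y z : squarefreez b ->
  c * x ^+ 2 + b * y ^+ 2 = z ^+ 2 -> coprimez x y -> coprimez x b.
Proof.
move=> sb e cxy; set g := gcdz x b.
have gx : (g %| x)%Z by apply: dvdz_gcdl.
have gb : (g %| b)%Z by apply: dvdz_gcdr.
have gx2 : (g ^+ 2 %| x ^+ 2)%Z by apply: dvdz_exp2r.
have gz : (g %| z)%Z.
  apply: (squarefreez_dvd_sqr (squarefreez_dvd gb sb)).
  by rewrite -e; apply: rpredD; [apply/dvdz_mull/dvdz_exp|apply: dvdz_mulr].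
have : (g ^+ 2 %| b * y ^+ 2)%Z.
  have -> : b * y ^+ 2 = z ^+ 2 - c * x ^+ 2 by rewrite -e; ring.
  by apply: rpredB; [exact: dvdz_exp2r|exact: dvdz_mull].
have cgy : coprimez (g ^+ 2) (y ^+ 2).
  by rewrite coprimezXl // coprimezXr // (coprimez_dvdl gx cxy).
rewrite Gauss_dvdzl // => /sb.
by rewrite ger0_norm // => g1; rewrite /coprimez -/g g1.
Qed.

(** If [g] divides [x] and [y] then [g^2] divides [z^2], so [g] divides [z] and the
    whole solution can be divided by the gcd of its first two coordinates. *)
Lemma isotropic_primitive a b : isotropic a b ->
  exists x y z : int, coprimez x y /\ a * x ^+ 2 + b * y ^+ 2 = z ^+ 2.
Proof.
case=> x [y [z [nz e]]]; set g := gcdz x y.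
have g0 : g != 0.
  rewrite gcdz_eq0; apply: contraTN nz => /andP[/eqP x0 /eqP y0].
  move: e; rewrite x0 y0 !expr0n !mulr0 addr0 => /esym/eqP.
  by rewrite sqrf_eq0 => ->; rewrite !eqxx.
have gx : x = (x %/ g)%Z * g by rewrite divzK ?dvdz_gcdl.
have gy : y = (y %/ g)%Z * g by rewrite divzK ?dvdz_gcdr.
have /dvdzP[t zt] : (g %| z)%Z.
  rewrite -(@dvdz_pexp2r _ _ 2) // -e gx gy !exprMn.
  by rewrite rpredD // dvdz_mull // dvdz_mull.
have cxy : coprimez (x %/ g)%Z (y %/ g)%Z.
  have [x0|x0] := eqVneq x 0; last exact: coprimez_div_gcd.
  rewrite coprimez_sym /g gcdzC; apply: coprimez_div_gcd.
  by move: g0; rewrite gcdz_eq0 x0 eqxx.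
exists (x %/ g)%Z, (y %/ g)%Z, t; split=> //.
apply: (@mulIf _ (g ^+ 2)); first by rewrite expf_neq0.
by rewrite -exprMn -zt -e {2}gx {2}gy; ring.
Qed.

(** Modulo [b] the equation reads [a x^2 = z^2], with [x] invertible. *)
Lemma isotropic_square_mod a b x y z : squarefreez b -> coprimez x y ->
  a * x ^+ 2 + b * y ^+ 2 = z ^+ 2 -> is_square_mod a b.
Proof.
move=> sb cxy e; have cxb := coprimez_of_norm_equation sb e cxy.
apply: (@is_square_mod_cancel (x ^+ 2)).
- exact: coprimezXl.
- exact: is_square_mod_sqr.
apply/is_square_modP; exists z; apply/dvdzP; exists (y ^+ 2).
by rewrite -e; ring.
Qed.

(** For the condition modulo the gcd [d], write [a = a1 d] and [b = b1 d]. Then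
    [d] divides [z = t d] and [a1 x^2 + b1 y^2 = d t^2], so that [- a1 b1 y^2] is
    congruent to [(a1 x)^2] modulo [d], with [y] invertible. *)
Lemma isotropic_legendre_conditions a b : squarefreez a -> squarefreez b ->
  isotropic a b -> legendre_conditions a b.
Proof.
move=> sa sb /isotropic_primitive[x [y [z [cxy e]]]].
have e' : b * y ^+ 2 + a * x ^+ 2 = z ^+ 2 by rewrite addrC.
have cyx : coprimez y x by rewrite coprimez_sym.
have cya := coprimez_of_norm_equation sa e' cyx.
have a0 := squarefreez_neq0 sa.
split.
- case=> an bn; have xy0 : (x != 0) || (y != 0).
    by rewrite -negb_and; apply: contraTN cxy => /andP[/eqP-> /eqP->].
  move: e xy0; nia.
- exact: isotropic_square_mod cxy e.
- exact: isotropic_square_mod cyx e'.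
have ad : a = (a %/ gcdz a b)%Z * gcdz a b by rewrite divzK ?dvdz_gcdl.
have bd : b = (b %/ gcdz a b)%Z * gcdz a b by rewrite divzK ?dvdz_gcdr.
have d0 : gcdz a b != 0 by rewrite gcdz_eq0 negb_and a0.
have cyd : coprimez y (gcdz a b) by apply: coprimez_dvdr cya; apply: dvdz_gcdl.
move: (gcdz a b) (a %/ _)%Z (b %/ _)%Z ad bd d0 cyd => d a1 b1 ad bd d0 cyd.
have /dvdzP[t zt] : (d %| z)%Z.
  apply: (@squarefreez_dvd_sqr d); last first.
    by rewrite -e ad bd; apply/dvdzP; exists (a1 * x ^+ 2 + b1 * y ^+ 2); ring.
  by apply: squarefreez_dvd sa; rewrite ad dvdz_mull.
have e1 : a1 * x ^+ 2 + b1 * y ^+ 2 = d * t ^+ 2.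
  by apply: (mulIf d0); move: e; rewrite ad bd zt => e1; rewrite -[RHS]mulrA; lia.
apply: (@is_square_mod_cancel (y ^+ 2)).
- exact: coprimezXl.
- exact: is_square_mod_sqr.
apply/is_square_modP; exists (a1 * x); apply/dvdzP; exists (a1 * t ^+ 2).
by rewrite -mulrA [t ^+ 2 * d]mulrC -e1; ring.
Qed.

(** * Sufficiency: descent *)

(** Multiplicativity of the norm from [Q(sqrt b)]: [a c m^2] is the norm of
    [t + sqrt b], so [a] is a norm as soon as [c] is one. The new solution is the
    expansion of [(t + sqrt b) (z + y sqrt b)]. *)
Lemma isotropic_descent a b c m t : c != 0 -> m != 0 ->
  t ^+ 2 - b = a * c * m ^+ 2 -> isotropic c b -> isotropic a b.
Proof.
move=> c0 m0 e [x [y [z [nz h]]]].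
have [x0|x0] := eqVneq x 0.
  (* If x = 0 the product formula could degenerate, but (0, y, z) still works. *)
  exists 0, y, z; split; first by move: nz; rewrite x0.
  by rewrite -h x0 !expr0n !mulr0.
exists (c * m * x), (t * y + z), (t * z + b * y); split.
  by rewrite !mulf_neq0.
rewrite (_ : a * _ = (a * c * m ^+ 2) * (c * x ^+ 2)); last by ring.
have -> : c * x ^+ 2 = z ^+ 2 - b * y ^+ 2 by rewrite -h; ring.
by rewrite -e; ring.
Qed.

(** The equation [t^2 - b = a c m^2] gives the conditions on [(c, b)]. Modulo [c]
    it makes [b] a square. Modulo [b] it makes [a c m^2] a square; this is enough to
    conclude for the part of [b] prime to [a], while modulo [d = gcd (a, b)] the
    equation has first to be divided by [d], and the last condition on [(a, b)] is
    used. Divided by [r = gcd (c, b)], it gives the last condition on [(c, b)]. *)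
Lemma legendre_conditions_descent a b c m t :
  squarefreez a -> squarefreez b -> squarefreez c ->
  t ^+ 2 - b = a * c * m ^+ 2 ->
  legendre_conditions a b -> legendre_conditions c b.
Proof.
move=> sa sb sc e [sgn sab sba sd].
have a0 := squarefreez_neq0 sa; have c0 := squarefreez_neq0 sc.
(* A divisor common to m and b would divide t, and its square would divide b. *)
have cmb : coprimez m b.
  apply: (@coprimez_of_norm_equation b (a * c) m 1 t) => //; last first.
    by rewrite coprimezE coprimen1.
  by rewrite -e; ring.
have sbc : is_square_mod b c.
  by apply/is_square_modP; exists t; rewrite e mulrAC dvdz_mull.
have scb : is_square_mod c b.
  have [d [a1 [b1 [[d0 dE ad bd c11] [aE bE]]]]] := gcdz_factor b a0.
  move: sd; rewrite dE aE bE => sd.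
  have sd' : squarefreez d by apply: squarefreez_dvd sa; rewrite ad dvdz_mull.
  have ca1d : coprimez a1 d by apply: squarefreez_coprime; rewrite -ad.
  have cb1d : coprimez b1 d by apply: squarefreez_coprime; rewrite -bd.
  have [cmb1 cmd] : coprimez m b1 /\ coprimez m d.
    by apply/andP; rewrite -coprimezMr -bd.
  have /dvdzP[t1 tE] : (d %| t)%Z.
    apply: (squarefreez_dvd_sqr sd').
    rewrite (_ : t ^+ 2 = a * c * m ^+ 2 + b); last by rewrite -e; ring.
    by rewrite ad bd; apply/dvdzP; exists (a1 * c * m ^+ 2 + b1); ring.
  have e1 : d * t1 ^+ 2 - b1 = a1 * c * m ^+ 2.
    apply: (mulIf d0).
    have -> : a1 * c * m ^+ 2 * d = a * c * m ^+ 2 by rewrite ad; ring.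
    by rewrite -e tE bd; ring.
  rewrite bd; apply: is_square_mod_chinese => //.
    apply: (@is_square_mod_cancel (a * m ^+ 2)).
    - by rewrite coprimezMl coprimezXl // andbT ad coprimezMl c11 coprimez_sym.
    - apply: is_square_modM; last exact: is_square_mod_sqr.
      by apply: is_square_mod_dvd sab; rewrite bd dvdz_mulr.
    apply/is_square_modP; exists t; apply/dvdzP; exists d.
    by rewrite [RHS]mulrC -bd mulrAC -e; ring.
  apply: (@is_square_mod_cancel ((a1 * m) ^+ 2)).
  - by rewrite coprimezXl // coprimezMl ca1d.
  - exact: is_square_mod_sqr.
  apply: is_square_mod_congr sd; apply/dvdzP; exists (- a1 * t1 ^+ 2).
  have -> : (a1 * m) ^+ 2 * c = a1 * (a1 * c * m ^+ 2) by ring.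
  by rewrite -e1; ring.
split=> //.
  case=> cn bn; have m0 : m != 0.
    by apply: contraTneq bn => m0; move: e; rewrite m0 expr0n mulr0; nia.
  have an : 0 < a by rewrite ltNge le_eqVlt (negPf a0); apply/negP=> an; apply: sgn.
  have : 0 < a * (- c) * m ^+ 2.
    by rewrite pmulr_lgt0 ?exprn_even_gt0 // pmulr_rgt0 // oppr_gt0.
  by rewrite mulrN mulNr -e; nia.
have [r [c1 [b1 [[r0 rE cr br _] [cE bE]]]]] := gcdz_factor b c0.
rewrite rE cE bE.
have sr : squarefreez r by apply: squarefreez_dvd sb; rewrite br dvdz_mull.
have /dvdzP[t1 tE] : (r %| t)%Z.
  apply: (squarefreez_dvd_sqr sr).
  rewrite (_ : t ^+ 2 = a * c * m ^+ 2 + b); last by rewrite -e; ring.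
  by rewrite cr br; apply/dvdzP; exists (a * c1 * m ^+ 2 + b1); ring.
have e1 : r * t1 ^+ 2 - b1 = a * c1 * m ^+ 2.
  apply: (mulIf r0).
  have -> : a * c1 * m ^+ 2 * r = a * c * m ^+ 2 by rewrite cr; ring.
  by rewrite -e tE br; ring.
have sq : is_square_mod (a * (c1 * m) ^+ 2) r.
  apply: is_square_modM; last exact: is_square_mod_sqr.
  by apply: is_square_mod_dvd sab; rewrite br dvdz_mull.
apply: is_square_mod_congr sq; apply/dvdzP; exists (c1 * t1 ^+ 2).
have -> : a * (c1 * m) ^+ 2 = c1 * (a * c1 * m ^+ 2) by ring.
by rewrite -e1; ring.
Qed.

(** Lagrange's descent on [|a| + |b|]. When [|b| < |a|], a small square root [t]
    of [b] modulo [a] gives [t^2 - b = a c m^2] with [c] squarefree and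
    [|c| < |a|], since [|a c| <= a^2 / 4 + |b|]; the pair [(a, b)] is then replaced
    by [(c, b)]. *)
Lemma legendre_conditions_isotropic a b : squarefreez a -> squarefreez b ->
  legendre_conditions a b -> isotropic a b.
Proof.
have [n] := ubnP (`|a| + `|b|)%N; elim: n a b => // n IHn a b.
wlog leba : a b / (`|b| <= `|a|)%N => [wlog_ab|] lt_n sa sb cond.
  have [ab|/ltnW ab] := leqP `|b| `|a|; first exact: wlog_ab.
  by apply/isotropicC/wlog_ab; rewrite 1?addnC //; apply: legendre_conditionsC.
have a0 := squarefreez_neq0 sa; have b0 := squarefreez_neq0 sb.
have [sgn sab sba sd] := cond.
have [b1|b1] := eqVneq b 1.
  by exists 0, 1, 1; split=> //; rewrite b1; ring.
have [abN|abN] := eqVneq b (- a).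
  by exists 1, 1, 0; split=> //; rewrite abN; ring.
have [a1|a1] := eqVneq a 1.
  by exists 1, 0, 1; split=> //; rewrite a1; ring.
have a2 : (1 < `|a|)%N by lia.
(* The forms <a, a, -1> and <a, -1, -1> are isotropic together: if
   a x^2 = y^2 + z^2 then a y^2 + a z^2 = (a x)^2. *)
have [ab|ab] := eqVneq b a.
  have sN1 : squarefreez (-1).
    move=> m mN1; have : (m %| -1)%Z by apply: dvdz_trans mN1; rewrite dvdz_exp.
    by rewrite dvdzE dvdn1 => /eqP m1; rewrite -abszE m1.
  have a_gt0 : 0 < a.
    by rewrite ltNge le_eqVlt (negPf a0); apply/negP=> an; apply: sgn; rewrite ab.
  have condN : legendre_conditions a (-1).
    split.
    - by case=> /ltW; rewrite leNgt a_gt0.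
    - by apply/is_square_modP; exists 0; rewrite dvdzE dvd1n.
    - by move: sd; rewrite ab gcdzz gtz0_abs // divzz a0 mulr1.
    - by apply/is_square_modP; exists 0; rewrite /gcdz gcdn1 dvdzE dvd1n.
  have [x [y [z [nz e]]]] : isotropic a (-1) by apply: IHn => //; lia.
  have e' : a * x ^+ 2 = y ^+ 2 + z ^+ 2 by rewrite -e; ring.
  exists y, z, (a * x); split.
    apply: contraTT nz; rewrite !negb_or !negbK mulf_eq0 (negPf a0) /=.
    by case/and3P=> -> -> ->.
  by rewrite ab -mulrDr -e'; ring.
have {ab} ltba : (`|b| < `|a|)%N by lia.
have [t [/dvdzP[k tk] t_small]] := is_square_mod_small a0 sba.
(* Otherwise b = t^2 is a squarefree square, that is, 1. *)
have k0 : k != 0.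
  apply: contraNneq b1 => k0; apply/eqP.
  have tb : t ^+ 2 = b by apply/eqP; rewrite -subr_eq0 tk k0 mul0r.
  have /sb : (t ^+ 2 %| b)%Z by rewrite tb.
  rewrite -tb; nia.
have [c [m [kc sc m0]]] := squarefreez_decomposition k0.
have c0 := squarefreez_neq0 sc.
have e : t ^+ 2 - b = a * c * m ^+ 2 by rewrite tk kc; ring.
apply: (isotropic_descent c0 m0 e); apply: IHn => //; last first.
  exact: legendre_conditions_descent e cond.
have ltca : `|c| < `|a|.
  rewrite ltNge; apply/negP=> leac.
  have t2 : 4 * t ^+ 2 <= `|a| ^+ 2.
    rewrite -real_normK ?num_real // (_ : 4 * _ = (2 * `|t|) ^+ 2); last by ring.
    by rewrite lerXn2r // nnegrE mulr_ge0.
  have m2 : 1 <= m ^+ 2 by rewrite -gtz0_ge1 exprn_even_gt0.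
  have ak : `|a| ^+ 2 <= `|t ^+ 2 - b|.
    rewrite e 2!normrM -mulrA expr2 ler_wpM2l // (le_trans leac) //.
    by rewrite ler_peMr // ger0_norm // (le_trans _ m2).
  have aa : 2 * `|a| <= `|a| ^+ 2 by rewrite expr2 ler_wpM2r //; lia.
  lia.
lia.
Qed.

(** * Norms from a quadratic field *)

(** The Galois group consists of the identity and of one more automorphism, which
    sends [s] to [- s]: an automorphism is determined by the image of [s], a square
    root of [z], and [- s] is a conjugate of [s] because [X^2 - z] is the minimal
    polynomial of [s]. *)
Lemma galNorm_sqrt (L : splittingFieldType rat) (z : rat) (s : L) :
  s ^+ 2 = z%:A -> s \notin 1%VS -> <<1; s>>%VS = {:L}%VS ->
  forall x y : rat, galNorm 1 {:L} (x%:A + y *: s) = (x ^+ 2 - z * y ^+ 2)%:A.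
Proof.
move=> sz s1 hL x y; rewrite -hL.
have pz : ('X^2 - (z%:A)%:P : {poly L}) \is a polyOver 1%VS.
  by rewrite rpredB ?rpredX ?polyOverX // polyOverC rpredZ ?mem1v.
have root_p u : root ('X^2 - (z%:A)%:P : {poly L}) u = (u ^+ 2 == s ^+ 2).
  by rewrite /root !hornerE subr_eq0 sz.
have := minPoly_dvdp pz; move/(_ s); rewrite root_p eqxx => /(_ isT) dvd.
have size_p : size ('X^2 - (z%:A)%:P : {poly L}) = 3 by rewrite size_XnsubC.
have deg : adjoin_degree 1 s = 2.
  have := dvdp_leq _ dvd; rewrite -size_poly_eq0 size_p size_minPoly => /(_ isT).
  have : adjoin_degree 1 s != 1 by rewrite adjoin_deg_eq1.

  by rewrite -[adjoin_degree _ _]/((_).-1.+1); case: (_.-1) => [|[|?]].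
have nL : normalField 1 <<1; s>> by rewrite hL normalFieldf.
have rN : root (minPoly 1 s) (- s).
  have eqp : minPoly 1 s %= ('X^2 - (z%:A)%:P : {poly L}).
    by rewrite -dvdp_size_eqp // size_p size_minPoly deg.
  by rewrite (eqp_root eqp) root_p sqrrN.
have [sg sgG sgs] : exists2 sg, sg \in ('Gal(<<1; s>> / 1))%g & sg s = - s.
  by apply: normalField_root_minPoly nL _ rN; rewrite ?sub1v ?memv_adjoin.
have sN : s != - s.
  apply: contraNneq s1 => /eqP; rewrite -subr_eq0 opprK -mulr2n -scaler_nat.
  by rewrite scaler_eq0 /= => /eqP->; apply: mem0v.
have sg1 : sg != 1%g.
  by apply: contraNneq sN => sg1; rewrite -sgs sg1 gal_id.
have GE : ('Gal(<<1; s>> / 1))%g = [set (1%g : gal_of <<1; s>>); sg].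
  apply/setP=> u; rewrite !inE; apply/idP/idP; last first.
    by case/orP=> /eqP-> //; apply: group1.
  move=> uG; have : (u s) ^+ 2 == s ^+ 2.
    by rewrite -rmorphXn /= sz (fixed_gal _ uG) ?sub1v // rpredZ ?mem1v.
  rewrite eqf_sqr !(gal_adjoin_eq uG) ?group1 // gal_id sgs //.
rewrite /galNorm GE big_setU1 ?inE 1?eq_sym // big_set1 gal_id.
rewrite !linearD !linearZ /= rmorph1 sgs.
rewrite scalerN mulrC -subr_sqr !exprZn sz expr1n scalerA -scalerBl.
by rewrite [z * _]mulrC.
Qed.

Lemma Fadjoin_sqrt (L : splittingFieldType rat) (z : rat) (s : L) :
  s ^+ 2 = z%:A ->
  forall u, u \in <<1; s>>%VS -> exists x y : rat, u = x%:A + y *: s.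
Proof.
move=> sz u /Fadjoin1_polyP[p ->]; elim/poly_ind: p => [|p c [x [y IHp]]].
  by exists 0, 0; rewrite rmorph0 horner0 !scale0r addr0.
exists (y * z + c), x; rewrite rmorphD rmorphM /= map_polyX map_polyC /=.
rewrite hornerMXaddC IHp mulrDl -!scalerAl mul1r -expr2 sz scalerA.
by rewrite scalerDl -addrA addrC.
Qed.

(** A squarefree integer other than 1 is not the square of a rational number. *)
Lemma square_ratio_eq1 (z x y : int) :
  squarefreez z -> x != 0 -> z * x ^+ 2 = y ^+ 2 -> z = 1.
Proof.
move=> sz x0 e.
have /dvdzP[t yt] : (x %| y)%Z by rewrite -(@dvdz_pexp2r _ _ 2) // -e dvdz_mull.
have zt : z = t ^+ 2.
  by apply: (@mulIf _ (x ^+ 2)); rewrite ?expf_neq0 // e yt exprMn.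
have /sz t1 : (t ^+ 2 %| z)%Z by rewrite zt.
by rewrite zt -real_normK ?num_real // t1.
Qed.

(** An element [a + b s] has norm [w] when [w = a^2 - z b^2]. Clearing denominators
    gives a zero of [z x^2 + w y^2 - t^2] with [y != 0]; conversely every nontrivial
    zero has [y != 0], because [z] is not a square. *)
Lemma is_norm_fromP (z w : int) (L : splittingFieldType rat) :
  in_Z z -> w != 0 -> is_Qsqrt z L -> is_norm_from L w <-> isotropic z w.
Proof.
case=> sz z1 w0 [s [ss hL]].
have ssA : s ^+ 2 = (z%:~R : rat)%:A by rewrite ss scaler_int.
have den0 (k : rat) : (denq k)%:~R != 0 :> rat by rewrite intr_eq0 denq_neq0.
have s1 : s \notin 1%VS.
  apply/negP=> /vlineP[k sk]; apply: z1.
  have kz : k ^+ 2 = z%:~R.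
    by apply: (@fmorph_inj _ _ (in_alg L)); rewrite /= -ssA sk exprZn expr1n.
  apply: (@square_ratio_eq1 z (denq k) (numq k)) => //.
  apply: (@intr_inj rat); rewrite rmorphM !rmorphXn /= -kz -exprMn.
  by rewrite numqE.
have normE := galNorm_sqrt ssA s1 hL.
have wA : w%:~R = (w%:~R : rat)%:A :> L by rewrite scaler_int.
split=> [[u [_]]|[x [y [t [nz e]]]]].
  have : u \in <<1; s>>%VS by rewrite hL memvf.
  case/(Fadjoin_sqrt ssA)=> a [b ->].
  rewrite /normQ normE wA => /(@fmorph_inj _ _ (in_alg L)) e.
  exists (numq b * denq a), (denq a * denq b), (numq a * denq b); split.
    by rewrite [X in _ || (X || _)](mulf_neq0 (denq_neq0 a) (denq_neq0 b)) orbT.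
  apply: (@intr_inj rat); rewrite rmorphD !rmorphM /= -e !numqE; ring.
have y0 : y != 0.
  apply/eqP=> y0; move: e nz; rewrite y0 expr0n mulr0 addr0 eqxx /=.
  have [->|x0] := eqVneq x 0; last by move=> /(square_ratio_eq1 sz x0).
  by rewrite expr0n mulr0 => /esym/eqP; rewrite sqrf_eq0 => ->.
pose u := (t%:~R / y%:~R : rat)%:A + (x%:~R / y%:~R) *: s.
have nu : normQ u = w%:~R.
  rewrite /normQ normE wA; congr (_%:A).
  have := congr1 (fun k : int => k%:~R : rat) e.
  rewrite rmorphD !rmorphM /= => e'.
  have yq : y%:~R != 0 :> rat by rewrite intr_eq0.
  rewrite !expr_div_n mulrA -mulrBl; apply: (canLR (mulfK _)).
    by rewrite expf_neq0.
  by rewrite (expr2 t%:~R) -e'; ring.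
exists u; split=> //; apply/eqP=> u0; move/eqP: nu; rewrite u0 /normQ galNorm0.
by rewrite wA eq_sym scaler_eq0 intr_eq0 (negPf w0) oner_eq0.
Qed.

Theorem proposition2p2 (z w : int) (L : splittingFieldType rat)
    (hz : in_Z z) (hw : in_Z w) (hL : is_Qsqrt z L) :
  let d := gcdz z w in
  is_norm_from L w <->
  [/\ ~ (z < 0 /\ w < 0),
      is_square_mod z (w %/ d)%Z,
      is_square_mod w (z %/ d)%Z &
      is_square_mod (- ((z * w) %/ d ^+ 2)%Z) d].
Proof.
move=> d; have [sz _] := hz; have [sw _] := hw.
apply: iff_trans (is_norm_fromP hz (squarefreez_neq0 sw) hL) _.
apply: iff_trans (legendre_conditionsE sz sw).
split; first exact: isotropic_legendre_conditions.
exact: legendre_conditions_isotropic.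
Qed.
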